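(* Let $G=(V,E,C)$ be a simple directed edge-labeled graph and let $\mathfrak{n}_G$ be the associated 2-step nilpotent Lie algebra. Then the abelian factor $\mathfrak{a}$ of $\mathfrak{n}_G$ is contained in the span of $\mathcal{A}(G)$.
   Context: A directed edge-labeled graph $G=(V,E,C)$ is a finite connected directed graph with vertex set $V=\{v_1,\dots,v_n\}$ and edge set $E$, together with a surjective labeling $c:E\to C=\{Z_1,\dots,Z_p\}$ (labels may be repeated on different edges). An edge directed from $v$ to $w$ is written $(v,w)$; when direction is irrelevant it is written $vw$. Simple means no loops and at most one edge between any two distinct vertices. The Lie algebra $\mathfrak{n}_G$: as a real vector space $\mathfrak{n}_G=\mathfrak{v}\oplus\mathfrak{w}$, where $\mathfrak{v}$ has basis $V$ and $\mathfrak{w}$ has basis $C$. The bracket is bilinear and skew-symmetric with $[v_i,v_j]=\sum_{\ell}(\epsilon_\ell-\epsilon'_\ell)Z_\ell$, where $\epsilon_\ell=1$ if $c(v_i,v_j)=Z_\ell$ and $0$ otherwise, and $\epsilon'_\ell=1$ if $c(v_j,v_i)=Z_\ell$ and $0$ otherwise; all other brackets of basis elements are zero. The derived algebra is $[\mathfrak{n}_G,\mathfrak{n}_G]=\mathfrak{w}$. The abelian factor of $\mathfrak{n}_G$ is the unique subspace $\mathfrak{a}\subseteq\mathfrak{v}$ such that the center satisfies $\mathcal{Z}(\mathfrak{n}_G)=[\mathfrak{n}_G,\mathfrak{n}_G]\oplus\mathfrak{a}$. For a vertex $v$, $N(v)$ is the set of vertices adjacent to $v$ (ignoring edge direction). For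 an edge label $Z$, $\deg_Z(v)=|\{w\in N(v): c(vw)=Z\}|$ is the number of edges incident to $v$ with label $Z$. Define $\mathcal{A}(G)=\{v\in V : \text{every } y\in N(v) \text{ has } \deg_{c(vy)}(y)>1\}$. *)

(* Defs.v *)
From HB Require Import structures.
From mathcomp Require Import all_boot all_order all_algebra.
From mathcomp Require Import reals.

Set Implicit Arguments.
Unset Strict Implicit.
Unset Printing Implicit Defensive.

Import GRing.Theory.
Local Open Scope ring_scope.

(* Edges form an abstract finite type with source and target maps, so that
   loops and multiple edges are possible until [simple_graph] rules them out. *)
Definition edge_joins (V E : finType) (src tgt : E -> V) (e : E) (v w : V) :=
  ((src e == v) && (tgt e == w)) || ((src e == w) && (tgt e == v)).

Record elgraph := ELGraph {
  vertex : finType;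
  edge : finType;
  label : finType;
  src : edge -> vertex;
  tgt : edge -> vertex;
  lab : edge -> label;
  lab_surj : forall Z : label, exists e, lab e = Z;
  vertex_gt0 : (0 < #|vertex|)%N;
  graph_connected : forall v w : vertex,
    connect (fun x y => [exists e, edge_joins src tgt e x y]) v w
}.

Section Graph.
Variable G : elgraph.

Definition joins (e : edge G) (v w : vertex G) : bool :=
  edge_joins (@src G) (@tgt G) e v w.

Definition simple_graph : Prop :=
  (forall e : edge G, src e <> tgt e) /\
  (forall (v w : vertex G) (e f : edge G),
     v <> w -> joins e v w -> joins f v w -> e = f).

(* c(v, w) = Z, for the edge directed from v to w *)
Definition dlab (v w : vertex G) (Z : label G) : bool :=
  [exists e, [&& src e == v, tgt e == w & lab e == Z]].

(* c(vw) = Z, for an edge between v and w of either direction *)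
Definition ulab (v w : vertex G) (Z : label G) : bool :=
  [exists e, joins e v w && (lab e == Z)].

Definition nbhd (v : vertex G) : {set vertex G} :=
  [set w | [exists e, joins e v w]].

Definition deg (Z : label G) (v : vertex G) : nat :=
  #|[set w in nbhd v | ulab v w Z]|.

Definition calA : {set vertex G} :=
  [set v | [forall y in nbhd v,
              [forall Z, ulab v y Z ==> (1 < deg Z y)%N]]].

End Graph.

(* The coordinates of a vector in the vertex basis and in the label basis. *)
Definition nalg (R : realType) (G : elgraph) : Type :=
  ({ffun vertex G -> R^o} * {ffun label G -> R^o})%type.

HB.instance Definition _ (R : realType) (G : elgraph) :=
  Vector.on (nalg R G).

Section LieAlgebra.
Variables (R : realType) (G : elgraph).
Local Notation n := (nalg R G).

Definition bv (v : vertex G) : n := ([ffun w => (w == v)%:R], 0).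
Definition bz (Z : label G) : n := (0, [ffun Y => (Y == Z)%:R]).

Definition vspan : {vspace n} := <<[seq bv v | v : vertex G]>>%VS.
Definition wspan : {vspace n} := <<[seq bz Z | Z : label G]>>%VS.

Definition vbracket (v w : vertex G) : n :=
  \sum_Z ((dlab v w Z)%:R - (dlab w v Z)%:R : R) *: bz Z.

Definition bracket (x y : n) : n :=
  \sum_v \sum_w (x.1 v * y.1 w : R) *: vbracket v w.

Fact bracket_linear_r x : linear (bracket x).
Proof.
move=> a y z; rewrite /bracket scaler_sumr -big_split /=; apply: eq_bigr => v _.
rewrite scaler_sumr -big_split /=; apply: eq_bigr => w _.
by rewrite !ffunE mulrDr scalerDl scalerA mulrCA.
Qed.
HB.instance Definition _ x :=
  GRing.isLinear.Build R n n _ (bracket x) (bracket_linear_r x).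

Lemma vbracketC v w : vbracket v w = - vbracket w v.
Proof.
rewrite /vbracket -sumrN; apply: eq_bigr => Z _.
by rewrite -scaleNr opprB.
Qed.

Lemma bracketC x y : bracket x y = - bracket y x.
Proof.
rewrite /bracket exchange_big /= -sumrN; apply: eq_bigr => v _.
rewrite -sumrN; apply: eq_bigr => w _.
by rewrite vbracketC scalerN mulrC.
Qed.

Lemma bracket_linear_l y : linear (bracket^~ y).
Proof.
by move=> a x z; rewrite !(bracketC _ y) linearP opprD -scalerN.
Qed.

Lemma bracket_vv v w : bracket (bv v) (bv w) = vbracket v w.
Proof.
rewrite /bracket (bigD1 v) //= (bigD1 w) //= !ffunE !eqxx mulr1 scale1r.
rewrite big1 ?addr0 => [|u /negPf uw]; last first.
  by rewrite !ffunE uw mulr0 scale0r.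
rewrite big1 ?addr0 // => u /negPf uv; apply: big1 => t _.
by rewrite !ffunE uv mul0r scale0r.
Qed.

Lemma bracket_zr x Z : bracket x (bz Z) = 0.
Proof.
by apply: big1 => v _; apply: big1 => w _; rewrite !ffunE mulr0 scale0r.
Qed.

Lemma vbracketE v w :
  vbracket v w = (0, [ffun Z => (dlab v w Z)%:R - (dlab w v Z)%:R]).
Proof.
rewrite /vbracket [LHS]surjective_pairing; congr (_, _).
  by rewrite (big_morph fst (id1 := 0) (op1 := +%R)) // big1 //= => Z _; rewrite scaler0.
rewrite (big_morph snd (id1 := 0) (op1 := +%R)) //=.
apply/ffunP=> Z; rewrite sum_ffunE !ffunE (bigD1 Z) //= !ffunE eqxx.
rewrite big1 ?addr0 => [|Y /negPf YZ]; last by rewrite !ffunE eq_sym YZ scaler0.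
by rewrite /GRing.scale /= mulr1.
Qed.

Lemma bracket_fst x y : (bracket x y).1 = 0.
Proof.
rewrite /bracket (big_morph fst (id1 := 0) (op1 := +%R)) // big1 // => v _.
rewrite (big_morph fst (id1 := 0) (op1 := +%R)) // big1 // => w _.
by rewrite vbracketE /= scaler0.
Qed.

Lemma bracket_2step x y z : bracket x (bracket y z) = 0.
Proof.
apply: big1 => v _; apply: big1 => w _.
by rewrite bracket_fst !ffunE mulr0 scale0r.
Qed.

Definition ad (x : n) : 'End(n) := linfun (bracket x).

Fact ad_linear : linear ad.
Proof.
move=> a x y; apply/lfunP => z.
rewrite /ad add_lfunE scale_lfunE !lfunE /=; exact: (bracket_linear_l z a x y).
Qed.
HB.instance Definition _ := GRing.isLinear.Build R n 'End(n) _ ad ad_linear.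

(* The kernel of the adjoint map; see [centerP]. *)
Definition center : {vspace n} := lker (linfun ad).

Lemma centerP x : x \in center <-> (forall y, bracket x y = 0).
Proof.
rewrite memv_ker lfunE /=; split=> [/eqP x0 y|x0].
  have := congr1 (fun f : 'End(n) => f y) x0.
  by rewrite /ad zero_lfunE lfunE.
apply/eqP/lfunP=> y; rewrite /ad zero_lfunE lfunE; exact: x0.
Qed.

(* [n, n]; brackets of a basis are enough by bilinearity, see [derivedP]. *)
Definition derived : {vspace n} :=
  <<[seq bracket x y | x <- vbasis (fullv : {vspace n}),
                       y <- vbasis (fullv : {vspace n})]>>%VS.

Lemma derivedP (U : {vspace n}) :
  (derived <= U)%VS <-> (forall x y, bracket x y \in U).
Proof.
split=> [sU x y|inU]; last first.
  by apply/span_subvP=> z /allpairsP[[x y] [_ _ ->]].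
apply: (subvP sU); rewrite (coord_vbasis (memvf x)) (coord_vbasis (memvf y)).
rewrite linear_sum; apply: rpred_sum => i _; rewrite linearZ; apply: rpredZ.
rewrite /= bracketC rpredN linear_sum; apply: rpred_sum => j _.
rewrite linearZ; apply: rpredZ; apply: memv_span => /=.
by apply: allpairs_f; apply: mem_nth; rewrite size_tuple.
Qed.

(* [vspan] is the summand spanned by the vertices. For simple graphs exactly
   one subspace satisfies this; see [abelian_factor_unique]. *)
Definition abelian_factor (a : {vspace n}) : Prop :=
  [/\ (a <= vspan)%VS, center = (derived + a)%VS & directv (derived + a)].

Lemma mem_vspan x : (x \in vspan) = (x.2 == 0).
Proof.
apply/idP/eqP=> [xv|x20].
  have /subvP/(_ _ xv) : (vspan <= lker (linfun (snd : n -> _)))%VS.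
    by apply/span_subvP=> _ /imageP[v _ ->]; rewrite memv_ker lfunE.
  by rewrite memv_ker lfunE => /eqP.
have -> : x = \sum_v (x.1 v : R) *: bv v.
  rewrite [LHS]surjective_pairing [RHS]surjective_pairing x20.
  rewrite (big_morph fst (id1 := 0) (op1 := +%R)) //=.
  rewrite (big_morph snd (id1 := 0) (op1 := +%R)) //=.
  rewrite [X in (_, X) = _](_ : _ = \sum_v (x.1 v : R) *: (bv v).2); last first.
    by rewrite big1 // => v _; rewrite scaler0.
  congr (_, _); apply/ffunP=> v; rewrite sum_ffunE (bigD1 v) //= !ffunE eqxx.
  rewrite big1 ?addr0 => [|w /negPf wv]; last by rewrite !ffunE eq_sym wv scaler0.
  by rewrite /GRing.scale /= mulr1.
apply: rpred_sum => v _; apply: rpredZ; apply: memv_span.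
by apply/imageP; exists v.
Qed.

Lemma mem_wspan x : (x \in wspan) = (x.1 == 0).
Proof.
apply/idP/eqP=> [xw|x10].
  have /subvP/(_ _ xw) : (wspan <= lker (linfun (fst : n -> _)))%VS.
    by apply/span_subvP=> _ /imageP[v _ ->]; rewrite memv_ker lfunE.
  by rewrite memv_ker lfunE => /eqP.
have -> : x = \sum_Z (x.2 Z : R) *: bz Z.
  rewrite [LHS]surjective_pairing [RHS]surjective_pairing x10.
  rewrite (big_morph fst (id1 := 0) (op1 := +%R)) //=.
  rewrite (big_morph snd (id1 := 0) (op1 := +%R)) //=.
  rewrite [X in (X, _) = _](_ : _ = \sum_Z (x.2 Z : R) *: (bz Z).1); last first.
    by rewrite big1 // => v _; rewrite scaler0.
  congr (_, _); apply/ffunP=> v; rewrite sum_ffunE (bigD1 v) //= !ffunE eqxx.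
  rewrite big1 ?addr0 => [|w /negPf wv]; last by rewrite !ffunE eq_sym wv scaler0.
  by rewrite /GRing.scale /= mulr1.
apply: rpred_sum => v _; apply: rpredZ; apply: memv_span.
by apply/imageP; exists v.
Qed.

Lemma derived_wspan : simple_graph G -> derived = wspan.
Proof.
case=> noloop uniqe; apply/eqP; rewrite eqEsubv; apply/andP; split.
  by apply/derivedP=> x y; rewrite mem_wspan bracket_fst.
apply/span_subvP=> _ /imageP[Z _ ->]; have [e eZ] := lab_surj Z.
have -> : bz Z = bracket (bv (src e)) (bv (tgt e)); last exact: (derivedP derived).1 (subvv _) _ _.
have st := noloop e.
have je : joins e (src e) (tgt e) by rewrite /joins /edge_joins !eqxx.
have je' : joins e (tgt e) (src e) by rewrite /joins /edge_joins !eqxx orbT.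
rewrite bracket_vv vbracketE; congr (_, _); apply/ffunP=> Y; rewrite !ffunE.
have -> : dlab (src e) (tgt e) Y = (Y == Z).
  apply/existsP/eqP=> [[f /and3P[/eqP fs /eqP ft /eqP <-]]|->].
    by rewrite -eZ (uniqe _ _ f e st) // /joins /edge_joins fs ft !eqxx.
  by exists e; rewrite eZ !eqxx.
have -> : dlab (tgt e) (src e) Y = false; last by rewrite subr0.
apply/existsP=> -[f /and3P[/eqP fs /eqP ft _]].
have ef : f = e by apply: (uniqe _ _ f e st) => //; rewrite /joins /edge_joins fs ft !eqxx orbT.
by apply: st; rewrite -fs ef.
Qed.

Lemma abelian_factor_unique :
  simple_graph G -> exists! a, abelian_factor a.
Proof.
move=> simG; have dw := derived_wspan simG.
have wz : (derived <= center)%VS.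
  by apply/derivedP=> x y; apply/centerP=> z; rewrite bracketC bracket_2step oppr0.
have vw0 x : x \in vspan -> x \in derived -> x = 0.
  rewrite dw mem_wspan mem_vspan => /eqP x2 /eqP x1.
  by rewrite [x]surjective_pairing x1 x2.
exists (center :&: vspan)%VS; split.
  split; first exact: capvSr.
    apply/eqP; rewrite eqEsubv subv_add wz capvSl !andbT.
    apply/subvP=> x xz; have x2w : (0, x.2) \in derived by rewrite dw mem_wspan.
    have -> : x = ((0, x.2) : n) + ((x.1, 0) : n).
      by rewrite [LHS]surjective_pairing; congr (_, _); rewrite ?add0r ?addr0.
    apply: memv_add => //; rewrite memv_cap mem_vspan eqxx andbT.
    have -> : ((x.1, 0) : n) = x - ((0, x.2) : n).
      by rewrite [X in X - _]surjective_pairing; congr (_, _); rewrite ?subr0 ?subrr.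
    by apply: rpredB => //; apply: (subvP wz).
  apply/directv_addP/eqP; rewrite -subv0; apply/subvP=> x.
  by rewrite !memv_cap memv0 => /and3P[xd _ xv]; rewrite (vw0 x).
move=> a [av za _]; apply/eqP; rewrite eqEsubv subv_cap av za addvSr !andbT.
apply/subvP=> x; rewrite memv_cap => /andP[/memv_addP[d dd [b ba ->]] dbv].
suff -> : d = 0 by rewrite add0r.
by apply: vw0 => //; rewrite -(addrK b d) rpredB // (subvP av).
Qed.

End LieAlgebra.

(* Main.v *)
Require Import Defs.
From mathcomp Require Import all_boot all_order all_algebra.
From mathcomp Require Import reals.

(** A vector of the abelian factor is a central combination [x] of vertices.
    Suppose that [v] is a vertex outside [calA G]: some neighbour [y] of [v] is
    joined to it by an edge with label [Z], and [v] is the only neighbour of [y]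
    along an edge with that label. In the Z-coordinate of [bracket x y] the edge
    [vy] is then the only one that contributes, so that this coordinate is [x_v] up
    to the sign given by the direction of the edge ([bracket_bv_lone_edge]). As
    [x] is central the coordinate is zero, and hence [x_v = 0]. So [x] is
    supported on [calA G]. *)

Set Implicit Arguments.
Unset Strict Implicit.
Unset Printing Implicit Defensive.

Import GRing.Theory.
Local Open Scope ring_scope.

Lemma ulab_dlab (G : elgraph) (v w : vertex G) (Z : label G) :
  ulab v w Z = dlab v w Z || dlab w v Z.
Proof.
apply/existsP/orP=> [[e /andP[/orP[] /andP[es et] eZ]]|[] /existsP[e]].
- by left; apply/existsP; exists e; rewrite es et.
- by right; apply/existsP; exists e; rewrite es et.
- by case/and3P=> es et eZ; exists e; rewrite /joins /edge_joins es et.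
- by case/and3P=> es et eZ; exists e; rewrite /joins /edge_joins es et orbT.
Qed.

Lemma ulabC (G : elgraph) (v w : vertex G) (Z : label G) :
  ulab v w Z = ulab w v Z.
Proof. by rewrite !ulab_dlab orbC. Qed.

Lemma ulab_nbhd (G : elgraph) (v w : vertex G) (Z : label G) :
  ulab v w Z -> w \in nbhd v.
Proof.
by case/existsP=> e /andP[je _]; rewrite inE; apply/existsP; exists e.
Qed.

(** Edges in both directions would be two edges between the same vertices, or
    a single edge that is a loop. *)
Lemma simple_dlab_asym (G : elgraph) (v w : vertex G) (Y Z : label G) :
  simple_graph G -> dlab v w Y -> ~~ dlab w v Z.
Proof.
case=> noloop uniqe /existsP[e /and3P[/eqP es /eqP et _]].
apply/existsP=> -[f /and3P[/eqP fs /eqP ft _]].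
have vw : v <> w by rewrite -es -et; apply: noloop.
have ef : e = f.
  by apply: (uniqe _ _ e f vw); rewrite /joins /edge_joins ?es ?et ?fs ?ft !eqxx ?orbT.
by apply: vw; rewrite -es ef fs.
Qed.

Lemma bracket_bv_coord (R : realType) (G : elgraph) (x : nalg R G)
    (y : vertex G) (Z : label G) :
  (bracket x (bv R y)).2 Z =
    \sum_w x.1 w * ((dlab w y Z)%:R - (dlab y w Z)%:R).
Proof.
have -> : bracket x (bv R y) = \sum_w (x.1 w : R) *: vbracket R w y.
  apply: eq_bigr => w _; rewrite (bigD1 y) //= !ffunE eqxx mulr1.
  by rewrite big1 ?addr0 // => u /negPf uy; rewrite !ffunE uy mulr0 scale0r.
rewrite (big_morph snd (id1 := 0) (op1 := +%R)) // sum_ffunE.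
by apply: eq_bigr => w _; rewrite vbracketE !ffunE.
Qed.

(** When only one edge at [y] has the label [Z], bracketing with [y] reads off,
    in its Z-coordinate, the coefficient of the other end of that edge. *)
Lemma bracket_bv_lone_edge (R : realType) (G : elgraph) (x : nalg R G)
    (v y : vertex G) (Z : label G) :
  simple_graph G -> ulab v y Z -> (deg Z y <= 1)%N ->
  (bracket x (bv R y)).2 Z = (-1) ^+ dlab y v Z * x.1 v.
Proof.
move=> simG vyZ degy.
have lone w : ulab w y Z -> w = v.
  move/card_le1_eqP: degy => lone wyZ.
  by apply: lone; rewrite inE -ulabC ?wyZ ?vyZ andbT;
     apply: (@ulab_nbhd _ _ _ Z); rewrite ulabC.
rewrite bracket_bv_coord (bigD1 v) //= big1 ?addr0 => [|w wv].
  move: vyZ; rewrite ulab_dlab; have [vy _|_ /= ->] := boolP (dlab v y Z).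
    by rewrite (negPf (simple_dlab_asym Z simG vy)) subr0 mulr1 mul1r.
  by rewrite sub0r mulrN1 expr1 mulN1r.
have /norP[/negPf-> /negPf->] : ~~ (dlab w y Z || dlab y w Z).
  by rewrite -ulab_dlab; apply: contra wv => /lone->.
by rewrite subr0 mulr0.
Qed.

Lemma center_coord0 (R : realType) (G : elgraph) (x : nalg R G)
    (v : vertex G) :
  simple_graph G -> x \in center R G -> v \notin calA G -> x.1 v = 0.
Proof.
move=> simG /centerP xz; rewrite inE => /forall_inPn[y _ /forallPn[Z]].
rewrite negb_imply -leqNgt => /andP[vyZ degy].
have := bracket_bv_lone_edge x simG vyZ degy.
by rewrite xz ffunE => /esym/eqP; rewrite mulf_eq0 signr_eq0 => /eqP.
Qed.

Lemma vspan_sum (R : realType) (G : elgraph) (x : nalg R G) :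
  x \in vspan R G -> x = \sum_v (x.1 v : R) *: bv R v.
Proof.
rewrite mem_vspan => /eqP x20.
rewrite [LHS]surjective_pairing [RHS]surjective_pairing x20; congr (_, _).
  rewrite (big_morph fst (id1 := 0) (op1 := +%R)) //=.
  apply/ffunP=> v; rewrite sum_ffunE (bigD1 v) //= !ffunE eqxx.
  rewrite big1 ?addr0 => [|w /negPf wv].
    by rewrite [RHS]mulr1.
  by rewrite !ffunE eq_sym wv scaler0.
rewrite (big_morph snd (id1 := 0) (op1 := +%R)) //= big1 // => v _.
by rewrite scaler0.
Qed.

Lemma mem_span_support (R : realType) (G : elgraph) (A : {set vertex G})
    (x : nalg R G) :
  x \in vspan R G -> (forall v, v \notin A -> x.1 v = 0) ->
  x \in <<[seq bv R v | v in A]>>%VS.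
Proof.
move=> xv x0; rewrite (vspan_sum xv); apply: rpred_sum => v _.
have [vA|/x0->] := boolP (v \in A); last by rewrite scale0r mem0v.
by apply/rpredZ/memv_span/imageP; exists v.
Qed.

Theorem theorem2p11 (R : realType) (G : elgraph) (a : {vspace nalg R G}) :
  simple_graph G -> abelian_factor a ->
  (a <= <<[seq bv R v | v in calA G]>>)%VS.
Proof.
move=> simG [av za _]; apply/subvP=> x xa.
apply: mem_span_support => [|v]; first exact: (subvP av).
by apply: center_coord0 => //; rewrite za (subvP (addvSr _ _)).
Qed.
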